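(* Let $D$ be a weakly locally finite division ring with center $F$. Then every finitely generated subnormal subgroup of $D^*$ is contained in $F$.
   Context: A division ring $D$ is weakly locally finite if for every finite subset $S\subseteq D$, the division subring generated by $S$ is finite dimensional over its own center. $D^*$ denotes the multiplicative group of $D$. *)

(* Defs.v *)
(* A division ring is a unitRingType (nontrivial ring,
   1 != 0) in which every nonzero element is a unit. Subsets of D are
   Prop-valued predicates D -> Prop. *)
From mathcomp Require Import all_boot all_order all_algebra.
Set Implicit Arguments. Unset Strict Implicit. Unset Printing Implicit Defensive.
Import GRing.Theory.
Local Open Scope ring_scope.

Section DivRingDefs.
Variable D : unitRingType.

Definition is_division_ring : Prop := forall x : D, x != 0 -> x \is a GRing.unit.

Definition division_subring (K : D -> Prop) : Prop :=
  [/\ K 1,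
      (forall x y, K x -> K y -> K (x - y)),
      (forall x y, K x -> K y -> K (x * y)) &
      (forall x, K x -> K x^-1)].

Definition divsubring_gen (S : D -> Prop) : D -> Prop :=
  fun x => forall K, division_subring K -> (forall y, S y -> K y) -> K x.

Definition center_of (K : D -> Prop) : D -> Prop :=
  fun x => K x /\ forall y, K y -> x * y = y * x.

Definition fin_dim_over_center (K : D -> Prop) : Prop :=
  exists n : nat, exists b : 'I_n -> D,
    (forall i, K (b i)) /\
    forall x, K x -> exists c : 'I_n -> D,
      (forall i, center_of K (c i)) /\ x = \sum_(i < n) c i * b i.

Definition weakly_locally_finite : Prop :=
  forall s : seq D, fin_dim_over_center (divsubring_gen (fun x => x \in s)).

Definition Dstar : D -> Prop := fun x => x != 0.

Definition subgroup_Dstar (G : D -> Prop) : Prop :=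
  [/\ G 1,
      (forall x, G x -> x != 0),
      (forall x y, G x -> G y -> G (x * y)) &
      (forall x, G x -> G x^-1)].

Definition normal_in (H K : D -> Prop) : Prop :=
  (forall h, H h -> K h) /\ (forall k h, K k -> H h -> H (k^-1 * h * k)).

Definition subnormal_Dstar (G : D -> Prop) : Prop :=
  exists r : nat, exists N : nat -> D -> Prop,
    (forall x, N 0%N x <-> G x) /\
    (forall x, N r x <-> Dstar x) /\
    (forall i, (i <= r)%N -> subgroup_Dstar (N i)) /\
    (forall i, (i < r)%N -> normal_in (N i) (N i.+1)).

Definition subgroup_gen (s : seq D) : D -> Prop :=
  fun x => forall H, subgroup_Dstar H -> (forall y, y \in s -> H y) -> H x.

Definition finitely_generated (G : D -> Prop) : Prop :=
  exists s : seq D, forall x, G x <-> subgroup_gen s x.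

Definition center_D : D -> Prop := fun x => forall y : D, x * y = y * x.

End DivRingDefs.

(* Main.v *)
(** Let [a] be in [G] and [b] in [D], and let [T] be the division ring generated by
    [b] and the generators of [G]. It is finite-dimensional over its center, and
    already over the subfield generated by finitely many structure constants.
    Removing algebraic generators of that subfield one at a time, [T] is
    finite-dimensional over a prime field of positive characteristic (and then
    commutative, by Wedderburn) or over the fraction field [K] of a central subring
    [A] isomorphic to the integers or to [E[x]].

    In the second case [T] acts on itself by matrices over [K], and since [G] is
    finitely generated the entries of its elements lie in [A[1/N]] for some [N].
    If [G] is [r] steps subnormal, then [phi^r (1 + t b)] is in [G] for all [t] in
    [K], where [phi y = y a y^-1]. Its entries are rational functions of [t]; a
    nonconstant rational function cannot take all its values in [A[1/N]], because the
    values of a nonconstant polynomial have infinitely many prime divisors. Hence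
    [phi^r (1 + t b) = phi^r 1 = a], so [phi^(r-1) (1 + t b)] commutes with its
    conjugate [a]; being an algebraic perturbation of [a] that vanishes at [t = 0], it
    equals [a]. Descending to [r = 1], [1 + t b] commutes with [a]. *)
From HB Require Import structures.
Require Import Defs.
From mathcomp Require Import all_boot all_order all_algebra all_field.
From mathcomp Require Import boolp.
From mathcomp Require Import ring zify.
Set Implicit Arguments. Unset Strict Implicit. Unset Printing Implicit Defensive.
Import GRing.Theory.
Local Open Scope ring_scope.

(** * Sparse units, and nonroots of polynomials over a domain *)

(* A form of "the units of [A] are too sparse to contain the values of a
   nonconstant polynomial" that holds for the integers and for [E[x]] alike. *)
Definition unit_sparse (A : comNzRingType) : Prop :=
  exists2 s : nat -> A, injective s &
    forall k (a : A), a != 0 -> 1 + s k * a != 0 /\ forall b : A, (1 + s k * a) * b != 1.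

(** The factor [k + 3] makes the absolute value of [1 + (k + 3) a] at least 2. *)
Lemma unit_sparse_int : unit_sparse int.
Proof.
exists (fun k => (k.+3)%:Z) => [k l [] //|k a nza].
split=> [|b]; first by lia.
apply/eqP => h.
have h1 : absz (1 + k.+3%:Z * a) = 1%N.
  have := congr1 absz h; rewrite abszM /= => /eqP; rewrite muln_eq1.
  by case/andP=> /eqP.
have h2 : (3 <= absz (k.+3%:Z * a)%R)%N by rewrite abszM /=; lia.
lia.
Qed.

(** For nonzero [a] the polynomial [1 + 'X^(k+1) * a] has positive degree. *)
Lemma unit_sparse_poly (E : fieldType) : unit_sparse {poly E}.
Proof.
exists (fun k => 'X^(k.+1) : {poly E}) => [k l h|k a nza].
  by have := congr1 (fun p : {poly E} => size p) h; rewrite !size_polyXn => -[].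
have sz : (1 < size (1 + 'X^(k.+1) * a)%R)%N.
  have h : (1 < size ('X^(k.+1) * a)%R)%N.
    rewrite mulrC size_mulXn //.
    by have := size_poly_gt0 a; rewrite nza; lia.
  by rewrite addrC size_polyDl // size_poly1.
split=> [|b]; first by rewrite -size_poly_gt0 (leq_trans _ sz).
apply/eqP => h.
have nzb : b != 0.
  by apply: contraTneq (oner_neq0 {poly E}) => b0; rewrite -h b0 mulr0 eqxx.
have nz : 1 + 'X^(k.+1) * a != 0 by rewrite -size_poly_gt0 (leq_trans _ sz).
have := congr1 (fun p : {poly E} => size p) h; rewrite size_mul // size_poly1.
move: sz nzb; rewrite -size_poly_gt0; case: (size b) => // m; case: (size _) => // l.
by rewrite addnS /=; lia.
Qed.

(** If [1 + d * z] divides [d ^+ k], it divides [(- (d * z)) ^+ k], which is congruent to 1 modulo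
    [1 + d * z]; the geometric sum supplies the cofactor. *)
Lemma coprime_dvd_exp_unit (A : comNzRingType) (d z b : A) k :
  (1 + d * z) * b = d ^+ k -> exists c, (1 + d * z) * c = 1.
Proof.
move=> h; exists (b * (- z) ^+ k + \sum_(i < k) (- (d * z)) ^+ i).
rewrite mulrDr mulrA h -exprMn mulrN.
have := subrX1 (- (d * z)) k.
set S := \sum_(i < k) _ => e.
have -> : (1 + d * z) * S = - ((- (d * z) - 1) * S) by ring.
by rewrite -e; ring.
Qed.

Lemma injective_nonroot (A : idomainType) (s : nat -> A) (p : {poly A}) :
  injective s -> p != 0 -> exists k, p.[s k] != 0.
Proof.
move=> sinj nzp; apply: contrapT => /forallNP h.
have /= := max_poly_roots nzp (rs := [seq s k | k <- iota 0 (size p)]).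
rewrite map_inj_uniq ?iota_uniq // size_map size_iota ltnn => h'.
suff: false by [].
apply: h' => //; apply/allP => x /mapP[k _ ->].
by rewrite /root; apply/negPn/negP/h.
Qed.

(** A denominator without zeros in [K] keeps [f] free of the convention [x / 0 = 0]. *)
Definition rational_fun (K : fieldType) (f : K -> K) : Prop :=
  exists p q : {poly K}, (forall s, q.[s] != 0) /\ forall s, f s = p.[s] / q.[s].

(** * Rational functions with values in a localization *)

Section FractionArithmetic.
Variables (A : idomainType) (K : fieldType) (j : {rmorphism A -> K}).
Hypothesis jinj : injective j.
Hypothesis frac : forall z : K, exists a b : A, b != 0 /\ z = j a / j b.
Hypothesis sparseA : unit_sparse A.

Let j_eq0 a : (j a == 0) = (a == 0).
Proof. by rewrite -(rmorph0 j) (inj_eq jinj). Qed.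

(* The subring [A[1/N]] of the fraction field [K]. *)
Definition localized (N : A) (z : K) : Prop :=
  exists a k, z * j N ^+ k = j a.

Lemma localized_img N a : localized N (j a).
Proof. by exists a, 0%N; rewrite mulr1. Qed.

Lemma localizedD N x y : localized N x -> localized N y -> localized N (x + y).
Proof.
move=> [a [k ha]] [b [l hb]]; exists (a * N ^+ l + b * N ^+ k), (k + l)%N.
by rewrite exprD rmorphD !rmorphM !rmorphXn /= -ha -hb; ring.
Qed.

Lemma localizedM N x y : localized N x -> localized N y -> localized N (x * y).
Proof.
move=> [a [k ha]] [b [l hb]]; exists (a * b), (k + l)%N.
by rewrite exprD rmorphM /= -ha -hb; ring.
Qed.

Lemma localizedN N x : localized N x -> localized N (- x).
Proof. by move=> [a [k ha]]; exists (- a), k; rewrite rmorphN /= -ha mulNr. Qed.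

Lemma localizedX N x k : localized N x -> localized N (x ^+ k).
Proof.
move=> hx; elim: k => [|k IH]; last by rewrite exprS; apply: localizedM.
by rewrite expr0 -(rmorph1 j); apply: localized_img.
Qed.

Lemma localized_sum N (I : finType) (F : I -> K) :
  (forall i, localized N (F i)) -> localized N (\sum_i F i).
Proof.
move=> h; apply: (big_ind (localized N)) => //.
- by rewrite -(rmorph0 j); apply: localized_img.
- by move=> x y; apply: localizedD.
Qed.

Lemma localizedW N M x : localized N x -> localized (N * M) x.
Proof.
move=> [a [k ha]]; exists (a * M ^+ k), k.
by rewrite !rmorphM !rmorphXn /= exprMn mulrA ha.
Qed.

Lemma localizedWr N M x : localized M x -> localized (N * M) x.
Proof. by rewrite mulrC; apply: localizedW. Qed.

Lemma localized_seq (zs : seq K) :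
  exists2 N : A, N != 0 & forall z, z \in zs -> localized N z.
Proof.
elim: zs => [|z zs [N nzN h]]; first by exists 1; rewrite ?oner_neq0.
have [a [b [nzb ->]]] := frac z.
exists (b * N) => [|x]; first by rewrite mulf_neq0.
rewrite inE => /orP[/eqP->|/h]; last exact: localizedWr.
by apply: localizedW; exists a, 1%N; rewrite expr1 divfK // j_eq0.
Qed.

Lemma localized_horner N (p : {poly K}) t :
  (forall z, z \in (p : seq K) -> localized N z) -> localized N t ->
  localized N p.[t].
Proof.
move=> hp ht; rewrite horner_coef; apply: localized_sum => i.
by apply: localizedM; [apply/hp/mem_nth|apply: localizedX].
Qed.

Lemma common_denominator (q : {poly K}) :
  exists (e : A) (Q : {poly A}), e != 0 /\ map_poly j Q = j e *: q.
Proof.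
elim/poly_ind: q => [|q c [e [Q [nze hQ]]]].
  by exists 1, 0; rewrite oner_neq0 rmorph0 scaler0.
have [a [b [nzb ->]]] := frac c.
exists (e * b), (b *: Q * 'X + (e * a)%:P); split; first by rewrite mulf_neq0.
rewrite rmorphD [X in X + _]rmorphM /= map_polyX map_polyC map_polyZ /= hQ !rmorphM /=.
rewrite scalerDr scalerAl scalerA [j b * j e]mulrC; congr (_ + _).
rewrite -!polyCM -mul_polyC -polyCM; congr polyC; field.
by rewrite j_eq0.
Qed.

(* Schur's argument for "a nonconstant polynomial has infinitely many prime
   divisors": [Q (t0 + c d s) = c (1 + d s g s)] where [c = Q t0], and the second
   factor is coprime to [d] without being a unit. *)
Lemma inv_poly_not_localized (q : {poly K}) (N : A) :
  (1 < size q)%N -> N != 0 ->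
  exists t : A, q.[j t] != 0 /\ ~ localized N (q.[j t])^-1.
Proof.
move=> szq nzN; have [s sinj hs] := sparseA.
have [e [Q [nze hQ]]] := common_denominator q.
have je : j e != 0 by rewrite j_eq0.
have szQ : size Q = size q.
  by rewrite -(size_map_inj_poly jinj (rmorph0 j)) hQ size_scale.
have nzQ : Q != 0 by rewrite -size_poly_gt0 szQ (leq_trans _ szq).
have [k0 nzc] := injective_nonroot sinj nzQ.
set t0 := s k0 in nzc; set c := Q.[t0] in nzc.
(* [e] clears the denominators of [q], and [N] those allowed in the localization: if [1 / q(t)] is
   localized, then [Q.[t]] divides a power of [d]. *)
pose d := e * N; have nzd : d != 0 by rewrite mulf_neq0.
have [Q1 hQ1] : exists Q1, Q - c%:P = Q1 * ('X - t0%:P).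
  by apply/factor_theorem; rewrite /root hornerD hornerN hornerC subrr.
have nzQ1 : Q1 != 0.
  apply: contraTneq szq => Q10; move: hQ1; rewrite Q10 mul0r => /eqP.
  by rewrite subr_eq0 -szQ => /eqP ->; rewrite size_polyC nzc.
pose g := Q1 \Po ((c * d) *: 'X + t0%:P).
have szl : size ((c * d) *: 'X + t0%:P) = 2%N.
  by rewrite -mul_polyC size_MXaddC polyC_eq0 mulf_eq0 (negPf nzc) (negPf nzd) /= size_polyC mulf_neq0.
have nzg : g != 0 by rewrite comp_poly2_eq0.
have [k1 nzgk] := injective_nonroot sinj nzg.
have [nzh nuh] := hs k1 (d * g.[s k1]) (mulf_neq0 nzd nzgk).
pose t := c * d * s k1 + t0; exists t.
have eQt : Q.[t] = c * (1 + s k1 * (d * g.[s k1])).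
  have -> : Q = Q1 * ('X - t0%:P) + c%:P by rewrite -hQ1 subrK.
  have -> : g.[s k1] = Q1.[t].
    by rewrite /g horner_comp hornerD hornerZ hornerX hornerC.
  by rewrite hornerD hornerM hornerXsubC hornerC /t; ring.
have eq : j e * q.[j t] = j Q.[t] by rewrite -horner_map hQ hornerZ.
have nzQt : Q.[t] != 0 by rewrite eQt mulf_neq0.
have nzqt : q.[j t] != 0.
  by apply: contraNneq nzQt => h; move: eq; rewrite h mulr0 => /esym/eqP; rewrite j_eq0.
split=> // -[a [k ha]].
have hd : Q.[t] * (a * e ^+ k) = e * N ^+ k * e ^+ k.
  apply: jinj; rewrite !rmorphM !rmorphXn /= -ha -eq; field; exact: nzqt.
have hdk : (1 + d * (s k1 * g.[s k1])) * (c * (a * e ^+ k) * N) = d ^+ k.+1.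
  transitivity (Q.[t] * (a * e ^+ k) * N); first by rewrite eQt; ring.
  by rewrite hd /d exprMn !exprS; ring.
have [b hb] := coprime_dvd_exp_unit hdk.
by case/eqP: (nuh b); apply: etrans hb; ring.
Qed.

(** Were the degree positive, the values at the points [1 / t], for nonzero [t] in [A], would put
    every [1 / t] into [A[1/(N M)]], which [inv_poly_not_localized] forbids for ['X]. Here [M] is a
    common denominator of the coefficients and of the inverse of the leading one. *)
Lemma polynomial_localized_const (p : {poly K}) (N : A) :
  N != 0 -> (forall s, localized N p.[s]) -> (size p <= 1)%N.
Proof.
move=> nzN hp; rewrite leqNgt; apply/negP => szp.
have nzp : p != 0 by rewrite -size_poly_gt0 (leq_trans _ szp).
pose m := (size p).-2; have szE : size p = m.+2 by rewrite /m; lia.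
have nzl : lead_coef p != 0 by rewrite lead_coef_eq0.
have [M nzM hM] := localized_seq ((lead_coef p)^-1 :: p).
have nzNM : N * M != 0 by rewrite mulf_neq0.
have [//|t [nzt]] := @inv_poly_not_localized 'X (N * M) _ nzNM.
  by rewrite size_polyX.
rewrite hornerX in nzt *; apply.
(* [lead / t = t^m p(1/t) - (a polynomial in t)] when [deg p = m + 1]. *)
have -> : (j t)^-1 = (lead_coef p)^-1 *
    (j t ^+ m * p.[(j t)^-1] - \sum_(i < m.+1) p`_i * j t ^+ (m - i)).
  have -> : j t ^+ m * p.[(j t)^-1] =
      \sum_(i < m.+1) p`_i * j t ^+ (m - i) + lead_coef p / j t.
    rewrite horner_coef szE big_ord_recr /= mulrDr mulr_sumr; congr (_ + _).
      apply: eq_bigr => i _; rewrite exprVn.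
      have -> : j t ^+ m = j t ^+ (m - i) * j t ^+ i by rewrite -exprD subnK // -ltnS.
      by rewrite mulrCA mulfK // expf_neq0.
    rewrite lead_coefE szE /= exprVn exprS invfM mulrCA; congr (_ * _).
    by rewrite mulrCA divff ?mulr1 // expf_neq0.
  by rewrite addrC addKr mulKf.
have ht : localized (N * M) (j t) by apply: localized_img.
apply: localizedM; first by apply/localizedWr/hM; rewrite mem_head.
apply: localizedD; first by apply: localizedM; [apply: localizedX|apply/localizedW/hp].
apply/localizedN/localized_sum => i; apply: localizedM; last exact: localizedX.
apply/localizedWr/hM; rewrite inE; apply/orP; right; apply: mem_nth.
by rewrite szE ltnS ltnW.
Qed.

(** Write [f = p / q] in lowest terms. A Bezout relation [u p + v q = 1] gives [1 / q = u f + v],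
    which is localized at the points of [A]; so [q] is constant and the polynomial case applies. *)
Lemma rational_localized_const (f : K -> K) (N : A) :
  rational_fun f -> N != 0 -> (forall s, localized N (f s)) ->
  forall s, f s = f 0.
Proof.
move=> [p0 [q0 [nzq0 hf0]]] nzN hN.
have [p [q [cpq nzq hf]]] : exists p q : {poly K},
    [/\ coprimep p q, forall s, q.[s] != 0 & forall s, f s = p.[s] / q.[s]].
  pose g := gcdp p0 q0.
  have nq0 : q0 != 0 by apply: contraTneq (nzq0 0) => ->; rewrite horner0 eqxx.
  have ng : g != 0 by rewrite gcdp_eq0 (negPf nq0) andbF.
  have ep : p0 = p0 %/ g * g by rewrite divpK // dvdp_gcdl.
  have eq : q0 = q0 %/ g * g by rewrite divpK // dvdp_gcdr.
  have nz s : (q0 %/ g).[s] != 0 /\ g.[s] != 0.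
    by apply/andP; rewrite -negb_or -mulf_eq0 -hornerM -eq.
  exists (p0 %/ g), (q0 %/ g); split.
  - by apply: coprimep_div_gcd; rewrite nq0 orbT.
  - by move=> s; case: (nz s).
  - move=> s; rewrite hf0 {1}ep {1}eq !hornerM; case: (nz s) => h1 h2.
    by field; rewrite h1 h2.
have [[u v] /= uv] := Bezout_eq1_coprimepP _ _ cpq.
have szq : (size q <= 1)%N.
  rewrite leqNgt; apply/negP => szq.
  have [M nzM hM] := localized_seq (u ++ v).
  have nzNM : N * M != 0 by rewrite mulf_neq0.
  have [t [nzt]] := inv_poly_not_localized szq nzNM; apply.
  have -> : (q.[j t])^-1 = u.[j t] * f (j t) + v.[j t].
    have := congr1 (fun r : {poly K} => r.[j t]) uv.
    rewrite hornerD !hornerM hornerC hf => h.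
    by rewrite -[LHS]mul1r -h; field; exact: nzt.
  have ht M' : localized M' (j t) by apply: localized_img.
  apply: localizedD.
    apply: localizedM; last exact/localizedW/hN.
    by apply/localizedWr/localized_horner => // z hz; apply: hM; rewrite mem_cat hz.
  by apply/localizedWr/localized_horner => // z hz; apply: hM; rewrite mem_cat hz orbT.
have [c nzc ec] : exists2 c, c != 0 & q = c%:P.
  apply/size_poly1P; rewrite eqn_leq szq size_poly_gt0.
  by apply: contraTneq (nzq 0) => ->; rewrite horner0 eqxx.
have hf' s : f s = (c^-1 *: p).[s] by rewrite hf ec hornerC hornerZ mulrC.
have hloc s : localized N (c^-1 *: p).[s] by rewrite -hf'.
by move=> s; rewrite !hf' (size1_polyC (polynomial_localized_const nzN hloc)) !hornerC.
Qed.
End FractionArithmetic.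

(** * Rational functions and rational matrices in one parameter *)

Section RationalFunctions.
Variable K : fieldType.
Implicit Types f g : K -> K.

Lemma rational_fun_poly (p : {poly K}) : rational_fun (fun s => p.[s]).
Proof.
exists p, 1; split=> s; rewrite hornerC ?oner_neq0 //.
by rewrite divr1.
Qed.

Lemma rational_fun_const c : rational_fun (fun _ : K => c).
Proof.
have [p [q [h1 h2]]] := rational_fun_poly c%:P.
by exists p, q; split=> // s; rewrite -h2 hornerC.
Qed.

Lemma rational_fun_id : rational_fun (@id K).
Proof.
have [p [q [h1 h2]]] := rational_fun_poly 'X.
by exists p, q; split=> // s; rewrite -h2 hornerX.
Qed.

Lemma rational_funD f g :
  rational_fun f -> rational_fun g -> rational_fun (fun s => f s + g s).
Proof.
move=> [p [q [hq hf]]] [p' [q' [hq' hg]]].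
exists (p * q' + p' * q), (q * q'); split=> s.
  by rewrite hornerM mulf_neq0.
by rewrite hf hg hornerD !hornerM; field; rewrite hq hq'.
Qed.

Lemma rational_funM f g :
  rational_fun f -> rational_fun g -> rational_fun (fun s => f s * g s).
Proof.
move=> [p [q [hq hf]]] [p' [q' [hq' hg]]].
exists (p * p'), (q * q'); split=> s.
  by rewrite hornerM mulf_neq0.
by rewrite hf hg !hornerM; field; rewrite hq hq'.
Qed.

Lemma rational_funV f :
  rational_fun f -> (forall s, f s != 0) -> rational_fun (fun s => (f s)^-1).
Proof.
move=> [p [q [hq hf]]] nzf; exists q, p.
have nzp s : p.[s] != 0.
  by apply: contraNneq (nzf s) => h; rewrite hf h mul0r.
by split=> // s; rewrite hf; field; rewrite hq nzp.
Qed.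

Lemma rational_fun_sum (I : finType) (F : I -> K -> K) :
  (forall i, rational_fun (F i)) -> rational_fun (fun s => \sum_i F i s).
Proof.
move=> h; rewrite unlock; elim: (index_enum I) => [|i r IH] /=.
  exact: rational_fun_const.
exact: rational_funD.
Qed.

Lemma rational_fun_prod (I : finType) (F : I -> K -> K) :
  (forall i, rational_fun (F i)) -> rational_fun (fun s => \prod_i F i s).
Proof.
move=> h; rewrite unlock; elim: (index_enum I) => [|i r IH] /=.
  exact: rational_fun_const.
exact: rational_funM.
Qed.

Lemma rational_fun_nonzero f :
  rational_fun f -> f 0 != 0 ->
  exists2 p : {poly K}, p != 0 & forall s, p.[s] != 0 -> f s != 0.
Proof.
move=> [p [q [hq hf]]] nz0; exists p => [|s nzp].
  by apply: contraNneq nz0 => p0; rewrite hf p0 horner0 mul0r.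
by rewrite hf mulf_neq0 ?invr_neq0.
Qed.

(** The injective sequence says that [K] is infinite: if the numerator of [f] were nonzero, its
    product with [p] would have a nonroot, where [f] both must and cannot vanish. *)
Lemma rational_fun_generic_zero (z : nat -> K) f (p : {poly K}) :
  injective z -> rational_fun f -> p != 0 ->
  (forall s, p.[s] != 0 -> f s = 0) -> forall s, f s = 0.
Proof.
move=> zinj [p' [q [hq hf]]] nzp h s; rewrite hf.
suff -> : p' = 0 by rewrite horner0 mul0r.
apply/eqP; apply: contraT => nzp'.
have nz : p * p' != 0 by rewrite mulf_neq0.
have [k] := injective_nonroot zinj nz.
rewrite hornerM mulf_eq0 negb_or => /andP[/h h1 /negP[]].
by move/eqP: h1; rewrite hf mulf_eq0 invr_eq0 (negPf (hq _)) orbF.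
Qed.

Definition rational_mx m n (f : K -> 'M[K]_(m, n)) : Prop :=
  forall i j, rational_fun (fun s => f s i j).

Lemma rational_mx_const m n (A : 'M[K]_(m, n)) : rational_mx (fun _ => A).
Proof. by move=> i j; apply: rational_fun_const. Qed.

Lemma rational_mxD m n (f g : K -> 'M[K]_(m, n)) :
  rational_mx f -> rational_mx g -> rational_mx (fun s => f s + g s).
Proof.
move=> hf hg i j; under eq_fun do rewrite mxE.
exact: rational_funD.
Qed.

Lemma rational_mxM m n p (f : K -> 'M[K]_(m, n)) (g : K -> 'M[K]_(n, p)) :
  rational_mx f -> rational_mx g -> rational_mx (fun s => f s *m g s).
Proof.
move=> hf hg i j; under eq_fun do rewrite mxE.
by apply: rational_fun_sum => k; apply: rational_funM.
Qed.

Lemma rational_mxZ m n (c : K -> K) (f : K -> 'M[K]_(m, n)) :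
  rational_fun c -> rational_mx f -> rational_mx (fun s => c s *: f s).
Proof.
move=> hc hf i j; under eq_fun do rewrite mxE.
exact: rational_funM.
Qed.

Lemma rational_mx_sum m n (I : finType) (F : I -> K -> 'M[K]_(m, n)) :
  (forall i, rational_mx (F i)) -> rational_mx (fun s => \sum_i F i s).
Proof.
move=> h i j; under eq_fun do rewrite summxE.
by apply: rational_fun_sum => k; apply: h.
Qed.

Lemma rational_fun_det n (f : K -> 'M[K]_n) :
  rational_mx f -> rational_fun (fun s => \det (f s)).
Proof.
move=> hf; apply: rational_fun_sum => u.
apply: rational_funM; first exact: rational_fun_const.
by apply: rational_fun_prod => i; apply: hf.
Qed.

(** Cramer's rule expresses the inverse through cofactors and a determinant without zeros. *)
Lemma rational_mx_inv n (f : K -> 'M[K]_n) :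
  rational_mx f -> (forall s, f s \in unitmx) ->
  rational_mx (fun s => invmx (f s)).
Proof.
move=> hf uf; have -> : (fun s => invmx (f s)) =
    fun s => (\det (f s))^-1 *: \adj (f s).
  by apply/funext => s; rewrite /invmx uf.
apply: rational_mxZ.
  apply: rational_funV => [|s]; first exact: rational_fun_det.
  by rewrite -unitfE -unitmxE.
move=> i j; under eq_fun do rewrite mxE.
apply: rational_funM; first exact: rational_fun_const.
apply: rational_fun_det => k l; under eq_fun do rewrite !mxE.
exact: hf.
Qed.

Lemma rational_mxX n (f : K -> 'M[K]_n.+1) k :
  rational_mx f -> rational_mx (fun s => f s ^+ k).
Proof.
move=> hf; elim: k => [|k IH]; first exact: rational_mx_const.
by under eq_fun do rewrite exprS; apply: rational_mxM.
Qed.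

(** Ensures a nonzero Taylor coefficient in every characteristic: normalized derivatives carry no
    factorials that could vanish. *)
Lemma nderivn_lead (p : {poly K}) : p != 0 ->
  p^`N((size p).-1) = (lead_coef p)%:P.
Proof.
move=> nzp; apply/polyP => -[|i]; rewrite coef_nderivn coefC.
  by rewrite addn0 binn mulr1n lead_coefE.
by rewrite nth_default ?mul0rn //; case: (size p) => // *; rewrite addnS ltnS leq_addr.
Qed.

(* With [w = y - a], Taylor's formula at [a] for the characteristic polynomial
   reads [0 = w ^ k * (c + O(w))] with [c] invertible, and [w] vanishes at [0]. *)
Lemma conjugate_commuting_const n (z : nat -> K) (a : 'M[K]_n.+1)
    (y : K -> 'M[K]_n.+1) :
  injective z -> rational_mx y -> y 0 = a ->
  (forall s, GRing.comm a (y s)) ->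
  (forall s, horner_mx (y s) (char_poly a) = 0) ->
  (forall p, horner_mx a p = 0 \/ horner_mx a p \is a GRing.unit) ->
  (forall s, y s - a = 0 \/ y s - a \is a GRing.unit) ->
  forall s, y s = a.
Proof.
move=> zinj raty y0 cy rooty unita unitw.
pose mu := char_poly a; pose w s := y s - a.
pose c i := horner_mx a mu^`N(i).
have nzmu : mu != 0 by apply/monic_neq0/char_poly_monic.
have exk : exists k, c k != 0.
  exists (size mu).-1; rewrite /c nderivn_lead // (monicP (char_poly_monic a)).
  by rewrite rmorph1 oner_neq0.
(* [k] is the order of vanishing of [mu] at [a]: the Taylor terms before it are zero, and [w s ^+ k]
   factors out of the others, leaving [B s]. *)
have [k nzck mink] := ex_minnP exk.
have uck : c k \is a GRing.unit by case: (unita mu^`N(k)) => // h; rewrite /c h eqxx in nzck.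
pose B s := \sum_(i < size mu - k) c (i + k)%N *m w s ^+ i.
have ratw : rational_mx w.
  by apply: rational_mxD => //; apply: rational_mx_const.
have taylor s : B s * w s ^+ k = 0.
  have /(nderiv_taylor_wide (n := k + (size mu - k))) : GRing.comm a (w s).
    by apply: commrB; [exact: cy | exact: commr_refl].
  move=> /(_ (map_poly (@scalar_mx K n.+1) mu)).
  rewrite [a + _]addrC subrK -[LHS]/(horner_mx (y s) mu) rooty.
  rewrite size_map_poly => /(_ _)-> //; last by rewrite -leq_subLR.
  rewrite big_split_ord /= big1 ?add0r => [|i _].
    rewrite mulr_suml; apply: eq_bigr => i _.
    by rewrite nderivn_map -mulrA -exprD [(i + k)%N]addnC.
  rewrite nderivn_map -[X in X * _]/(c i).
  case: (eqVneq (c i) 0) => [->|/mink]; first by rewrite mul0r.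
  by rewrite leqNgt ltn_ord.
have ratB : rational_fun (fun s => \det (B s)).
  apply/rational_fun_det/rational_mx_sum => i.
  by apply: rational_mxM; [apply: rational_mx_const|apply: rational_mxX].
have B0 : B 0 = c k.
  have klt : (0 < size mu - k)%N.
    rewrite subn_gt0 ltnNge; apply/negP => h; move: nzck.
    by rewrite /c nderivn_poly0 // rmorph0 eqxx.
  rewrite /B /w y0 subrr; move: klt; case: (size mu - k)%N => // m _.
  rewrite big_ord_recl /= expr0 mulmx1 big1 ?addr0 // => i _.
  by rewrite exprS mul0r mulmx0.
have nzB0 : \det (B 0) != 0 by rewrite B0 -unitfE -unitmxE.
have [p nzp hp] := rational_fun_nonzero ratB nzB0.
(* An invertible [w s] would force [B s = 0], so [w] vanishes off the roots of [p], hence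
   everywhere, its entries being rational. *)
have w0 s : p.[s] != 0 -> w s = 0.
  move=> /hp nzdet; case: (unitw s) => // uw.
  have : B s = 0 by apply: (mulIr (unitrX k uw)); rewrite taylor mul0r.
  by move=> h; rewrite h det0 eqxx in nzdet.
move=> s; apply/eqP; rewrite -subr_eq0 -/(w s); apply/eqP/matrixP => i j.
rewrite [RHS]mxE; apply: (rational_fun_generic_zero zinj (ratw i j) nzp) => t ht.
by rewrite w0 // mxE.
Qed.
End RationalFunctions.

(** * Division subrings as ring types, and Wedderburn's little theorem *)

Section SubringType.
Variables (D : unitRingType) (hD : is_division_ring D) (S : D -> Prop).
Hypothesis hS : division_subring S.

(** Taking the proof as an argument lets the closure instance below attach to the predicate. *)
Definition divsub_pred of division_subring S : {pred D} := fun x => `[< S x >].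
Local Notation P := (divsub_pred hS).

Lemma divsub_pred_closed : divring_closed P.
Proof.
case: hS => h1 hB hM hV; split; first exact/asboolP.
- by move=> x y /asboolP hx /asboolP hy; apply/asboolP/hB.
- by move=> x y /asboolP hx /asboolP hy; apply/asboolP/hM => //; apply: hV.
Qed.
HB.instance Definition _ := GRing.isDivringClosed.Build D P divsub_pred_closed.

Record divsub_type := DivsubType { divsub_val :> D; _ : divsub_val \in P }.

HB.instance Definition _ := [isSub for divsub_val].
HB.instance Definition _ := [Choice of divsub_type by <:].
HB.instance Definition _ := [SubChoice_isSubUnitRing of divsub_type by <:].

Lemma divsub_typeP (x : divsub_type) : S (val x).
Proof. by case: x => y /= /asboolP. Qed.

Lemma divsub_type_of x : S x -> exists u : divsub_type, x = val u.
Proof. by move=> /asboolP hx; exists (DivsubType hx). Qed.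

Lemma divsub_type_fieldP : GRing.field_axiom divsub_type.
Proof.
move=> x nz; have ux : val x \is a GRing.unit.
  by apply: hD; apply: contraNneq nz => h; apply/eqP/val_inj; rewrite rmorph0.
have hV : (val x)^-1 \in P by rewrite rpredV; case: x {nz ux}.
apply/unitrP; exists (DivsubType hV).
by split; apply: val_inj; rewrite rmorphM rmorph1 /= ?mulVr ?mulrV.
Qed.

(** Polynomials and matrices need scalars in a field type; a commutative division subring supplies
    them in this form. *)
Lemma subfield_exists : (forall x y, S x -> S y -> x * y = y * x) ->
  exists (F : fieldType) (f : {rmorphism F -> D}),
    forall x, S x <-> exists k, x = f k.
Proof.
move=> hc; have mulC : commutative (@GRing.mul divsub_type).
  by move=> x y; apply: val_inj; rewrite !rmorphM; apply: hc; apply: divsub_typeP.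
pose cR : comUnitRingType :=
  HB.pack divsub_type (GRing.PzRing_hasCommutativeMul.Build divsub_type mulC).
pose F : fieldType :=
  HB.pack cR (GRing.ComUnitRing_isField.Build cR divsub_type_fieldP).
exists F, (val : {rmorphism divsub_type -> D}) => x; split=> [|[k ->]].
  exact: divsub_type_of.
exact: divsub_typeP.
Qed.

(** The list [xs] embeds the subring into the finite type [seq_sub xs]; the resulting finite domain
    is commutative by Wedderburn's little theorem. *)
Lemma wedderburn_subring (xs : seq D) : (forall x, S x -> x \in xs) ->
  forall x y, S x -> S y -> x * y = y * x.
Proof.
move=> hxs.
pose g (u : divsub_type) : seq_sub xs := SeqSub (hxs _ (divsub_typeP u)).
pose g' (v : seq_sub xs) : option divsub_type := insub (val v).
have gK : pcancel g g' by move=> u; rewrite /g /g' /= valK.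
pose cT : countType := HB.pack divsub_type (PCanIsCountable gK).
have gK' : @pcancel _ cT g g' := gK.
pose R : finUnitRingType := HB.pack divsub_type (PCanIsCountable gK) (PCanIsFinite gK').
have dom : GRing.integral_domain_axiom R := @GRing.IdomainMixin R divsub_type_fieldP.
move=> x y /divsub_type_of[u ->] /divsub_type_of[v ->].
by rewrite -!rmorphM; congr val; apply: (finDomain_mulrC dom).
Qed.
End SubringType.

(** * Finite dimension over a division subring *)

Section DivisionSubrings.
Variable D : unitRingType.
Hypothesis hD : is_division_ring D.
Implicit Types (K T S : D -> Prop) (x y z : D).

Lemma divring_mulf_eq0 x y : (x * y == 0) = (x == 0) || (y == 0).
Proof.
have [->|nzx] := eqVneq x 0; first by rewrite mul0r eqxx.
by rewrite (mulrI_eq0 _ (mulrI (hD nzx))).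
Qed.

Section Closure.
Variable K : D -> Prop.
Hypothesis hK : division_subring K.

Lemma divsub1 : K 1. Proof. by case: hK. Qed.
Lemma divsubB x y : K x -> K y -> K (x - y). Proof. by case: hK => _ h _ _; apply: h. Qed.
Lemma divsubM x y : K x -> K y -> K (x * y). Proof. by case: hK => _ _ h _; apply: h. Qed.
Lemma divsubV x : K x -> K x^-1. Proof. by case: hK => _ _ _ h; apply: h. Qed.
Lemma divsub0 : K 0. Proof. by rewrite -(subrr 1); apply: divsubB; apply: divsub1. Qed.
Lemma divsubN x : K x -> K (- x).
Proof. by move=> hx; rewrite -sub0r; apply: divsubB => //; apply: divsub0. Qed.
Lemma divsubD x y : K x -> K y -> K (x + y).
Proof. by move=> hx hy; rewrite -[y]opprK; apply: divsubB => //; apply: divsubN. Qed.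
Lemma divsub_sum (I : finType) (F : I -> D) : (forall i, K (F i)) -> K (\sum_i F i).
Proof. by move=> h; apply: big_ind => //; [apply: divsub0 | apply: divsubD]. Qed.
End Closure.

Lemma divsubring_gen_division S : division_subring (divsubring_gen S).
Proof.
split=> [K hK _|x y hx hy K hK hS|x y hx hy K hK hS|x hx K hK hS].
- exact: divsub1.
- by apply: divsubB; [|apply: hx|apply: hy].
- by apply: divsubM; [|apply: hx|apply: hy].
- by apply: divsubV; [|apply: hx].
Qed.

Lemma sub_divsubring_gen S x : S x -> divsubring_gen S x.
Proof. by move=> hx K _; apply. Qed.

Lemma divsubring_gen_sub S K : division_subring K -> (forall x, S x -> K x) ->
  forall x, divsubring_gen S x -> K x.
Proof. by move=> hK hS x; apply. Qed.

Lemma comm_invr x y : x * y = y * x -> x^-1 * y = y * x^-1.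
Proof.
by move=> h; apply/esym; apply: (@commrV D y x); apply/esym.
Qed.

Lemma center_of_division K : division_subring K -> division_subring (center_of K).
Proof.
move=> hK; split=> [|x y [hx cx] [hy cy]|x y [hx cx] [hy cy]|x [hx cx]].
- by split=> [|y _]; [apply: divsub1|rewrite mul1r mulr1].
- by split=> [|z hz]; [apply: divsubB|rewrite mulrBl mulrBr cx // cy].
- split=> [|z hz]; first exact: divsubM.
  by rewrite -mulrA cy // mulrA cx // mulrA.
- split=> [|y hy]; first exact: divsubV.
  by apply/comm_invr/cx.
Qed.

Definition spans K (I : finType) (b : I -> D) x : Prop :=
  exists2 c : I -> D, forall i, K (c i) & x = \sum_i c i * b i.

(** Any finite index type is allowed, so that products of spanning families need no renumbering. *)
Definition fin_dim K T : Prop :=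
  exists (I : finType) (b : I -> D),
    (forall i, T (b i)) /\ forall x, T x -> spans K b x.

Lemma fin_dim_wide K K' T : (forall x, K x -> K' x) -> fin_dim K T -> fin_dim K' T.
Proof.
move=> hK [I [b [hb h]]]; exists I, b; split=> // x /h[c hc ->].
by exists c => // i; apply: hK.
Qed.

Lemma fin_dim_trans K L T : division_subring T ->
  (forall x, L x -> T x) -> fin_dim K L -> fin_dim L T -> fin_dim K T.
Proof.
move=> hT hLT [I [b [hb hL]]] [J [b' [hb' hT']]].
exists (J * I)%type, (fun ij => b ij.2 * b' ij.1); split=> [ij|x /hT'[c hc ->]].
  by apply: divsubM => //; apply: hLT.
have /choice[e he] j : exists e : I -> D,
    (forall i, K (e i)) /\ c j = \sum_i e i * b i.
  by have [e h1 h2] := hL _ (hc j); exists e.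
exists (fun ij => e ij.1 ij.2) => [ij|]; first by case: (he ij.1).
rewrite -(pair_bigA _ (fun j i => e j i * (b i * b' j))) /=.
apply: eq_bigr => j _; case: (he j) => _ ->; rewrite mulr_suml.
by apply: eq_bigr => i _; rewrite mulrA.
Qed.

Section OverField.
Variables (F : fieldType) (f : {rmorphism F -> D}).

(** The coordinate matrix has one more row than columns, so its left kernel contains a nonzero row
    [u]. *)
Lemma dependent_of_spans (I : finType) (b : I -> D) (x : 'I_#|I|.+1 -> D) :
  (forall k, spans (fun y => exists c, y = f c) b (x k)) ->
  exists2 u : 'rV[F]_#|I|.+1, u != 0 & \sum_k f (u 0 k) * x k = 0.
Proof.
move=> h.
have /choice[M hM] k : exists c : I -> F, x k = \sum_i f (c i) * b i.
  have [c /choice[c' hc'] ->] := h k; exists c'.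
  by apply: eq_bigr => i _; rewrite hc'.
pose A := \matrix_(k < #|I|.+1, i < #|I|) M k (enum_val i).
have /rowV0Pn[u /sub_kermxP uA nzu] : kermx A != 0.
  by rewrite kermx_eq0 /row_free neq_ltn ltnS rank_leq_col.
exists u => //.
transitivity (\sum_i (\sum_k f (u 0 k) * f (M k i)) * b i).
  under eq_bigr do rewrite hM mulr_sumr.
  rewrite exchange_big /=; apply: eq_bigr => i _; rewrite mulr_suml.
  by apply: eq_bigr => k _; rewrite mulrA.
rewrite big1 // => i _.
suff -> : \sum_k f (u 0 k) * f (M k i) = 0 by rewrite mul0r.
have /(congr1 (fun B : 'rV[F]_#|I| => f (B 0 (enum_rank i)))) := uA.
rewrite !mxE rmorph0 rmorph_sum /= => h0; rewrite -[RHS]h0.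
by apply: eq_bigr => k _; rewrite mxE enum_rankK rmorphM.
Qed.

Lemma algebraic_of_spans (I : finType) (b : I -> D) z :
  (forall k, spans (fun y => exists c, y = f c) b (z ^+ k)) ->
  exists2 p : {poly F}, p != 0 & (map_poly f p).[z] = 0.
Proof.
move=> h; have [k|u nzu hu] := @dependent_of_spans I b (fun k => z ^+ k).
  exact: h.
exists (rVpoly u) => [|].
  by apply: contraNneq nzu => h0; rewrite -(rVpolyK u) h0 linear0.
rewrite (@horner_coef_wide _ #|I|.+1) ?size_map_poly ?size_poly //.
rewrite -[RHS]hu; apply: eq_bigr => k _.
by rewrite coef_map /= coef_rVpoly_ord.
Qed.

(** Cancel factors [z] until the constant term [c] is nonzero; the relation then reads
    [p(z) z = - c], and [- c^-1 p(z)] inverts [z]. *)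
Lemma algebraic_inv z (p : {poly F}) : (forall k, z * f k = f k * z) ->
  z != 0 -> p != 0 -> (map_poly f p).[z] = 0 ->
  exists q : {poly F}, z^-1 = (map_poly f q).[z].
Proof.
move=> cz nzz; elim/poly_ind: p => [|p c IH]; first by rewrite eqxx.
rewrite rmorphD rmorphM /= map_polyX map_polyC /= hornerMXaddC.
have [->|nzc] := eqVneq c 0.
  rewrite (rmorph0 f) !addr0 => nzp /eqP; rewrite divring_mulf_eq0 (negPf nzz) orbF.
  move=> /eqP; apply: IH; apply: contraNneq nzp => ->; rewrite mul0r //.
move=> _ /eqP; rewrite addr_eq0 => /eqP h.
exists (- c^-1 *: p); apply: (mulIr (hD nzz)).
by rewrite mulVr ?hD // map_polyZ /= hornerZ -mulrA h rmorphN mulrNN -rmorphM mulVf // rmorph1.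
Qed.
End OverField.

(** The powers of a nonzero [z] in [T] are dependent over the field [K], so [z] is algebraic and its
    inverse is a polynomial in [z]. *)
Lemma fin_dim_division K T : division_subring K ->
  (forall x, K x -> T x) -> (forall x y, K x -> T y -> x * y = y * x) ->
  T 1 -> (forall x y, T x -> T y -> T (x - y)) ->
  (forall x y, T x -> T y -> T (x * y)) -> fin_dim K T -> division_subring T.
Proof.
move=> hK KT cKT T1 TB TM [I [b [hb hT]]]; split=> // z hz.
have cK x y : K x -> K y -> x * y = y * x by move=> hx /KT; apply: cKT.
have [F [f fE]] := subfield_exists hD hK cK.
have [->|nzz] := eqVneq z 0; first by rewrite invr0 -(subrr 1); apply: TB.
have TX k : T (z ^+ k) by elim: k => [|k IH]; rewrite ?expr0 ?exprS //; apply: TM.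
have [k|p nzp pz] := @algebraic_of_spans F f I b z.
  by have [c hc ->] := hT _ (TX k); exists c => // i; apply/fE.
have cz k : z * f k = f k * z by apply/esym/cKT => //; apply/fE; exists k.
have [q ->] := algebraic_inv cz nzz nzp pz.
have TS n (G : 'I_n -> D) : (forall i, T (G i)) -> T (\sum_i G i).
  have T0 : T 0 by rewrite -(subrr 1); apply: TB.
  move=> h; apply: big_ind => // x y hx hy; rewrite -[y]opprK -[- y]sub0r.
  by apply: (TB) => //; apply: (TB).
rewrite horner_coef; apply: TS => i; rewrite coef_map; apply: (TM) => //.
by apply/KT/fE; eexists.
Qed.
End DivisionSubrings.

(** * Reduction to an arithmetic base or to a commutative ring *)

Section Reduction.
Variable D : unitRingType.
Hypothesis hD : is_division_ring D.
Implicit Types (K T : D -> Prop) (x y z : D).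

(** [K] is generated by the coordinates of 1, of the generators and of the products [b i * b j]. The
    products make the [K]-span [L] of [b] a ring, finite dimension makes it a division ring, and it
    contains the generators of [T]. *)
Lemma fin_dim_fin_gen_center (s : seq D) :
  let T := divsubring_gen (fun x => x \in s) in fin_dim_over_center T ->
  exists cs : seq D, (forall c, c \in cs -> center_of T c) /\
    fin_dim (divsubring_gen (fun x => x \in cs)) T.
Proof.
move=> T [n [b [hb hspan]]].
have hT : division_subring T by apply: divsubring_gen_division.
(* Outside [T] the coordinates are set to 0, which makes [coord] total. *)
have /choice[coord hcoord] x : exists c : 'I_n -> D, T x ->
    (forall i, center_of T (c i)) /\ x = \sum_(i < n) c i * b i.
  case: (pselect (T x)) => hx; last by exists (fun=> 0).
  by have [c hc] := hspan x hx; exists c.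
pose xs := 1 :: s ++ [seq b ij.1 * b ij.2 | ij <- enum {: 'I_n * 'I_n}].
pose cs := [seq coord xi.1 xi.2 | xi <- allpairs pair xs (enum 'I_n)].
pose K := divsubring_gen (fun x => x \in cs).
have Txs x : x \in xs -> T x.
  rewrite inE => /orP[/eqP->|]; first exact: (divsub1 hT).
  rewrite mem_cat => /orP[hx|/mapP[ij _ ->]]; first exact: sub_divsubring_gen.
  exact: (divsubM hT).
have hcs c : c \in cs -> center_of T c.
  case/mapP=> xi /allpairsP[[x i] /= [hx _ ->]] -> /=.
  by case: (hcoord x (Txs x hx)).
have hK : division_subring K by apply: divsubring_gen_division.
have KZ x : K x -> center_of T x.
  by apply: divsubring_gen_sub => //; apply: center_of_division.
exists cs; split=> //.
pose L := spans K b.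
have LT x : L x -> T x.
  move=> [c hc ->]; apply: (divsub_sum hT) => i; apply: (divsubM hT) => //.
  by have [] := KZ _ (hc i).
have Lxs x : x \in xs -> L x.
  move=> hx; have [_ e] := hcoord x (Txs x hx); exists (coord x) => // i.
  apply: sub_divsubring_gen; apply/mapP; exists (x, i) => //.
  by apply/allpairsP; exists (x, i); rewrite mem_enum.
have LZ k x : K k -> L x -> L (k * x).
  move=> hk [c hc ->]; exists (fun i => k * c i) => [i|]; first exact: (divsubM hK).
  by rewrite mulr_sumr; apply: eq_bigr => i _; rewrite mulrA.
have LB x y : L x -> L y -> L (x - y).
  move=> [c hc ->] [d hd ->]; exists (fun i => c i - d i) => [i|].
    exact: (divsubB hK).
  by rewrite -sumrB; apply: eq_bigr => i _; rewrite mulrBl.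
have L0 : L 0 by have := LB _ _ (Lxs 1 (mem_head _ _)) (Lxs 1 (mem_head _ _)); rewrite subrr.
have LD x y : L x -> L y -> L (x + y).
  by move=> hx hy; rewrite -[y]opprK -[- y]sub0r; apply: (LB) => //; apply: (LB).
have Lsum (G : 'I_n -> D) : (forall i, L (G i)) -> L (\sum_i G i).
  by move=> h; apply: big_ind.
have Lb i : L (b i).
  exists (fun j => (j == i)%:R) => [j|].
    by case: (j == i); [apply: (divsub1 hK)|apply: (divsub0 hK)].
  by rewrite (bigD1 i) //= eqxx mul1r big1 ?addr0 // => j /negPf ->; rewrite mul0r.
have LM x y : L x -> L y -> L (x * y).
  move=> [c hc ->] [d hd ->]; rewrite mulr_suml; apply: (Lsum) => i.
  rewrite mulr_sumr; apply: (Lsum) => j.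
  have -> : c i * b i * (d j * b j) = c i * d j * (b i * b j).
    rewrite -!mulrA; congr (_ * _); rewrite !mulrA; congr (_ * _).
    by have [_ ->] := KZ _ (hd j).
  apply: LZ; first exact: (divsubM hK).
  apply: Lxs; rewrite inE mem_cat; apply/orP; right; apply/orP; right.
  by apply/mapP; exists (i, j); rewrite ?mem_enum.
have KL x : K x -> L x by move=> hx; rewrite -[x]mulr1; apply: LZ => //; apply: Lxs; apply: mem_head.
have hL : division_subring L.
  apply: (@fin_dim_division D hD K) => //.
  - by move=> x y /KZ[_ h] /LT; apply: h.
  - by apply: Lxs; apply: mem_head.
  - by exists 'I_n, b.
exists 'I_n, b; split=> // x; apply: divsubring_gen_sub => // y hy.
by apply: Lxs; rewrite inE mem_cat hy orbT.
Qed.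

Definition fractions (A : idomainType) (iota : {rmorphism A -> D}) x : Prop :=
  exists a b : A, b != 0 /\ x = iota a / iota b.

Lemma fractions_division (A : idomainType) (iota : {rmorphism A -> D}) :
  injective iota -> division_subring (fractions iota).
Proof.
move=> inj; have u b : b != 0 -> iota b \is a GRing.unit.
  by move=> nzb; apply: hD; rewrite -(rmorph0 iota) (inj_eq inj).
have c a b : iota a * iota b = iota b * iota a by rewrite -!rmorphM mulrC.
have cV a b : (iota b)^-1 * iota a = iota a / iota b by apply: comm_invr.
split.
- by exists 1, 1; rewrite oner_neq0 rmorph1 divr1.
- move=> _ _ [a [b [nzb ->]]] [a' [b' [nzb' ->]]].
  exists (a * b' - a' * b), (b * b'); split; first by rewrite mulf_neq0.
  apply: (mulIr (u _ (mulf_neq0 nzb nzb'))); rewrite divrK ?u ?mulf_neq0 //.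
  rewrite mulrBl rmorphB !rmorphM /= mulrA divrK ?u //.
  by rewrite [iota b * _]c mulrA divrK ?u.
- move=> _ _ [a [b [nzb ->]]] [a' [b' [nzb' ->]]].
  exists (a * a'), (b * b'); split; first by rewrite mulf_neq0.
  apply: (mulIr (u _ (mulf_neq0 nzb nzb'))); rewrite divrK ?u ?mulf_neq0 //.
  rewrite !rmorphM /= [iota b * _]c mulrA -[_ * iota b']mulrA divrK ?u //.
  by rewrite -mulrA [iota a' * _]c mulrA divrK ?u.
- move=> _ [a [b [nzb ->]]].
  have [->|nza] := eqVneq a 0.
    by exists 0, 1; rewrite oner_neq0 rmorph0 mul0r invr0 mul0r.
  exists b, a; split=> //; apply: (mulIr (u _ nza)); rewrite divrK ?u //.
  by rewrite invrM ?unitrV ?u // invrK -mulrA mulVr ?u ?mulr1.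
Qed.

Lemma sub_fractions (A : idomainType) (iota : {rmorphism A -> D}) a :
  fractions iota (iota a).
Proof. by exists a, 1; rewrite oner_neq0 rmorph1 divr1. Qed.

Definition arithmetic_base T : Prop :=
  exists (A : idomainType) (iota : {rmorphism A -> D}),
    [/\ unit_sparse A, injective iota, forall a, center_of T (iota a)
      & fin_dim (fractions iota) T].

Lemma rmorph_inj0 (A : nzRingType) (g : {rmorphism A -> D}) :
  (forall a, g a = 0 -> a = 0) -> injective g.
Proof.
move=> h a b e; apply/eqP; rewrite -subr_eq0; apply/eqP/h.
by rewrite rmorphB e subrr.
Qed.

(** Induction on [cs], with [E] the field generated by the tail. A head [c] transcendental over [E]
    makes the polynomial ring over [E] an arithmetic base; an algebraic [c] generates a finite
    extension of [E], and is dropped by the tower law. *)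
Lemma fin_dim_descend T (cs : seq D) : division_subring T ->
  (forall c, c \in cs -> center_of T c) ->
  fin_dim (divsubring_gen (fun x => x \in cs)) T ->
  arithmetic_base T \/ fin_dim (divsubring_gen (fun x => x \in [::])) T.
Proof.
move=> hT; elim: cs => [|c cs IH] hcs fd; first by right.
have hcs' d : d \in cs -> center_of T d by move=> h; apply: hcs; rewrite inE h orbT.
have [cT ccT] := hcs c (mem_head _ _).
pose E := divsubring_gen (fun x => x \in cs).
have hE : division_subring E by apply: divsubring_gen_division.
have EZ x : E x -> center_of T x.
  by apply: divsubring_gen_sub => //; apply: center_of_division.
have [F [f fE]] : exists (F : fieldType) (f : {rmorphism F -> D}),
    forall x, E x <-> exists k, x = f k.
  by apply: (subfield_exists hD hE) => x y /EZ[_ h] /EZ[hy _]; apply: h.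
have Ef k : E (f k) by apply/fE; exists k.
have cf : commr_rmorph f c by move=> k; apply: ccT; case: (EZ _ (Ef k)).
pose ev : {rmorphism {poly F} -> D} := horner_morph cf.
have evC k : ev k%:P = f k by rewrite /ev /= horner_morphC.
have evX : ev 'X = c by rewrite /ev /= horner_morphX.
have evZ q : center_of T (ev q).
  elim/poly_ind: q => [|q k IHq].
    by rewrite rmorph0; apply: (divsub0 (center_of_division hT)).
  rewrite rmorphD rmorphM /= evX evC; have hZ := center_of_division hT.
  by apply: (divsubD hZ); [apply: (divsubM hZ) => //; apply: hcs; apply: mem_head|apply: EZ].
case: (pselect (exists2 p : {poly F}, p != 0 & ev p = 0)) => [[p nzp evp]|notalg]; last first.
  left; exists {poly F}, ev.
  have inj : injective ev.
    apply: rmorph_inj0 => q q0; apply: contrapT => nzq; apply: notalg.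
    by exists q => //; apply/eqP.
  split=> //; first exact: unit_sparse_poly.
  apply: fin_dim_wide fd => x; apply: divsubring_gen_sub.
    exact: fractions_division.
  move=> y; rewrite inE => /orP[/eqP->|hy].
    by rewrite -evX; apply: sub_fractions.
  have /fE[k ->] : E y by apply: sub_divsubring_gen.
  by rewrite -evC; apply: sub_fractions.
apply: IH => //; pose L x := exists q, x = ev q.
have LT x : L x -> T x by move=> [q ->]; case: (evZ q).
have EL x : E x -> L x by move=> /fE[k ->]; exists k%:P; rewrite evC.
(* Reduction modulo [p] leaves only powers of [c] with exponent below [size p]. *)
have fdL : fin_dim E L.
  exists 'I_(size p), (fun i : 'I_(size p) => c ^+ i); split=> [i|_ [q ->]].
    by exists 'X^i; rewrite rmorphXn /= evX.
  have szr : (size (q %% p)%R <= size p)%N by rewrite ltnW // ltn_modp.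
  exists (fun i : 'I_(size p) => f (q %% p)`_i) => [i|]; first exact: Ef.
  rewrite {1}(divp_eq q p) rmorphD rmorphM /= evp mulr0 add0r.
  rewrite /ev /= /horner_morph (@horner_coef_wide _ (size p)) ?size_map_poly //.
  by apply: eq_bigr => i _; rewrite coef_map.
have hL : division_subring L.
  apply: (@fin_dim_division D hD E) => //.
  - by move=> x y /EZ[_ h] /LT; apply: h.
  - by exists 1; rewrite rmorph1.
  - by move=> _ _ [q ->] [q' ->]; exists (q - q'); rewrite rmorphB.
  - by move=> _ _ [q ->] [q' ->]; exists (q * q'); rewrite rmorphM.
apply: (fin_dim_trans hT LT fdL); apply: fin_dim_wide fd => x.
apply: divsubring_gen_sub => // y; rewrite inE => /orP[/eqP->|hy].
  by exists 'X; rewrite evX.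
by apply: EL; apply: sub_divsubring_gen.
Qed.

(** In characteristic zero the integers give an arithmetic base. In characteristic [p] the prime
    field is finite, so [T] has finitely many elements and Wedderburn applies. *)
Lemma fin_dim_prime T : division_subring T ->
  fin_dim (divsubring_gen (fun x => x \in [::])) T ->
  arithmetic_base T \/ forall x y, T x -> T y -> x * y = y * x.
Proof.
move=> hT fd; pose E := divsubring_gen (fun x : D => x \in [::]).
case: (pselect (exists n, n.+1%:R = 0 :> D)) => [[n n0]|char0]; last first.
  left; exists int, (intmul 1 : {rmorphism int -> D}).
  have natinj m : m%:R = 0 :> D -> m = 0%N.
    by case: m => // m h; case: char0; exists m.
  have inj : injective (intmul 1 : int -> D).
    apply: (@rmorph_inj0 int (intmul 1)) => -[m|m] /=.
      by move/natinj ->.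
    by rewrite NegzE rmorphN /= => /eqP; rewrite oppr_eq0 => /eqP/natinj.
  split=> //; first exact: unit_sparse_int.
    move=> z; split=> [|y _]; last exact/esym/commr_int.
    have hN m : T m%:R.
      elim: m => [|m IH]; first exact: divsub0.
      by rewrite -addn1 natrD; apply: divsubD => //; apply: divsub1.
    case: z => m; first exact: hN.
    by rewrite NegzE rmorphN /=; apply: divsubN => //; apply: hN.
  apply: fin_dim_wide fd => x; apply: divsubring_gen_sub => //.
  exact: fractions_division.
right.
have hE : division_subring E by apply: divsubring_gen_division.
(* The smallest division subring is contained in its own center. *)
have cE x y : E x -> E y -> x * y = y * x.
  move=> hx hy; have hZ := center_of_division hE.
  by case: (divsubring_gen_sub hZ _ hx (S := fun x => x \in [::])) => // _; apply.
have [F [f fE]] := subfield_exists hD hE cE.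
have nF : n.+1%:R == 0 :> F by rewrite -(fmorph_eq0 f) rmorph_nat n0.
have [p pF] := natf0_pchar (ltn0Sn n) nF.
have pD : p \in [pchar D].
  by move: pF; rewrite !inE => /andP[-> /=]; rewrite -(fmorph_eq0 f) rmorph_nat.
have pr := pcharf_prime pD; have p0 := pcharf0 pD.
pose N x := exists k : nat, x = k%:R.
have hN : division_subring N.
  split=> [|_ _ [k ->] [l ->]|_ _ [k ->] [l ->]|_ [k ->]]; first by exists 1%N.
  - exists (k + l * p.-1)%N; rewrite natrD natrM; congr (_ + _).
    suff -> : (p.-1)%:R = -1 :> D by rewrite mulrN1.
    by apply/eqP; rewrite -addr_eq0 natr1 prednK ?prime_gt0 // p0.
  - by exists (k * l)%N; rewrite natrM.
  - have [->|nzk] := eqVneq (k%:R : D) 0; first by exists 0%N; rewrite invr0.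
    (* By Fermat's little theorem [k ^ (p - 2)] inverts [k] modulo [p]. *)
    exists (k ^ p.-2)%N; rewrite natrX; set x : D := k%:R.
    have ux : x \is a GRing.unit by apply: hD.
    apply: (mulIr ux); apply: (mulIr ux); rewrite mulVr // mul1r -!exprSr.
    have -> : p.-2.+2 = p by have := prime_gt1 pr; lia.
    rewrite -natrX -(GRing.natr_mod_pchar pD) fermat_little //.
    by rewrite GRing.natr_mod_pchar.
have [I [b [hb hspan]]] := fd.
(* Coordinates are integers that matter only modulo [p], so this list exhausts [T]. *)
pose xs := [seq \sum_i (val (g i))%:R * b i | g : {ffun I -> 'I_p}].
apply: (wedderburn_subring hD hT (xs := xs)) => x /hspan[c hc ->].
have /choice[k hk] i : exists k : nat, c i = k%:R.
  exact: (divsubring_gen_sub hN _ (hc i)).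
apply/mapP; exists [ffun i => Ordinal (ltn_pmod (k i) (prime_gt0 pr))].
  by rewrite mem_enum.
by apply: eq_bigr => i _; rewrite ffunE /= GRing.natr_mod_pchar // hk.
Qed.
End Reduction.

(** * The regular representation by matrices *)

Section RegularRepresentation.
Variables (D : unitRingType) (F : fieldType) (f : {rmorphism F -> D}).
Hypothesis hD : is_division_ring D.
Variable T : D -> Prop.
Hypothesis hT : division_subring T.
Hypothesis centerf : forall k, center_of T (f k).
Hypothesis fdT : fin_dim (fun x => exists k, x = f k) T.

(** A spanning family of least length is free. It is nonempty because 1 is nonzero, and the form
    [n.+1] of its length gives square matrices their ring structure. *)
Lemma fin_dim_basis : exists n, exists b : 'I_n.+1 -> D,
  [/\ forall i, T (b i),
      forall x, T x -> exists c : 'rV[F]_n.+1, x = \sum_i f (c 0 i) * b i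
    & forall c : 'rV[F]_n.+1, \sum_i f (c 0 i) * b i = 0 -> c = 0].
Proof.
pose P n := exists b : 'I_n -> D, (forall i, T (b i)) /\
  forall x, T x -> exists c : 'I_n -> F, x = \sum_i f (c i) * b i.
have exP : exists n, `[< P n >].
  have [I [b [hb h]]] := fdT; exists #|I|; apply/asboolP.
  exists (fun i => b (enum_val i)); split=> [i|x /h[c /choice[c' hc'] ->]] //.
  exists (fun i => c' (enum_val i)).
  rewrite (reindex (@enum_val I I)) /=; last exact/onW_bij/enum_val_bij.
  by apply: eq_bigr => i _; rewrite hc'.
have [n /asboolP[b [hb hspan]] minP] := ex_minnP exP.
case: n => [|n] in b hb hspan minP *.
  have [c] := hspan 1 (divsub1 hT); rewrite big_ord0 => /eqP.
  by rewrite oner_eq0.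
exists n, b; split=> // [x /hspan[c ->]|c h0].
  by exists (\row_i c i); apply: eq_bigr => i _; rewrite mxE.
apply/rowP => k; rewrite [RHS]mxE; apply/eqP; apply: contraT => nzc.
suff /asboolP/minP : P n by rewrite ltnn.
(* A relation with [c 0 k] nonzero eliminates [b k], against minimality: subtract the multiple of it
   that cancels the coordinate [d k]. *)
exists (fun i => b (lift k i)); split=> // x /hspan[d hd].
pose l := d k / c 0 k; exists (fun i => d (lift k i) - l * c 0 (lift k i)).
transitivity (\sum_i f (d i - l * c 0 i) * b i).
  under eq_bigr do rewrite rmorphB rmorphM /= mulrBl -mulrA.
  by rewrite sumrB -mulr_sumr h0 mulr0 subr0.
by rewrite (bigD1_ord k) //= /l divfK // subrr rmorph0 mul0r add0r.
Qed.

(** [rho x] is the matrix of right multiplication by [x] on a left basis; with coordinates in rows,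
    the order of products is preserved. Linearity over [F] comes from the centrality of the
    scalars. *)
Lemma regular_representation : exists n, exists rho : D -> 'M[F]_n.+1,
  [/\ rho 1 = 1,
      forall x y, T x -> T y -> rho (x * y) = rho x * rho y,
      forall x y k, T x -> T y -> rho (x + f k * y) = rho x + k *: rho y
    & forall x, T x -> rho x = 0 -> x = 0].
Proof.
have [n [b [hb hspan free]]] := fin_dim_basis.
have /choice[co hco] x : exists c : 'rV[F]_n.+1, T x -> x = \sum_i f (c 0 i) * b i.
  case: (pselect (T x)) => [/hspan[c ->]|nx]; first by exists c.
  by exists 0.
pose rho x := \matrix_(i, j) co (b i * x) 0 j.
have rhoE x i : T x -> b i * x = \sum_j f (rho x i j) * b j.
  move=> hx; rewrite {1}(hco (b i * x)); last exact: (divsubM hT).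
  by apply: eq_bigr => j _; rewrite mxE.
have rhoU x (M : 'M_n.+1) : T x ->
    (forall i, b i * x = \sum_j f (M i j) * b j) -> rho x = M.
  move=> hx hM; apply/row_matrixP => i; apply/eqP; rewrite -subr_eq0; apply/eqP/free.
  under eq_bigr do rewrite !mxE rmorphB mulrBl.
  rewrite sumrB -hM -[X in X - _](_ : b i * x = _) ?subrr //.
  by rewrite [LHS]rhoE //; apply: eq_bigr => j _; rewrite mxE.
have cf k i : b i * f k = f k * b i by have [_ ->] := centerf k.
exists n, rho; split.
- apply: rhoU => [|i]; first exact: (divsub1 hT).
  rewrite mulr1 (bigD1 i) //= mxE eqxx rmorph1 mul1r big1 ?addr0 // => j.
  by rewrite mxE eq_sym => /negPf ->; rewrite rmorph0 mul0r.
- move=> x y hx hy; apply: rhoU => [|i]; first exact: (divsubM hT).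
  rewrite mulrA rhoE // mulr_suml.
  under eq_bigr do rewrite -mulrA rhoE // mulr_sumr.
  rewrite exchange_big /=; apply: eq_bigr => k _.
  rewrite -[rho x * rho y]/(rho x *m rho y) [in RHS]mxE rmorph_sum mulr_suml.
  by apply: eq_bigr => j _; rewrite rmorphM mulrA.
- move=> x y k hx hy; apply: rhoU => [|i].
    by apply: (divsubD hT) => //; apply: (divsubM hT) => //; case: (centerf k).
  rewrite mulrDr mulrA cf -mulrA !rhoE // mulr_sumr -big_split /=.
  by apply: eq_bigr => j _; rewrite !mxE rmorphD rmorphM mulrDl mulrA.
(* A nonzero [x] with [rho x = 0] would make every [b i] zero, yet the [b i] span 1. *)
- move=> x hx rx0; apply/eqP; apply: contraT => nzx.
  have b0 i : b i = 0.
    apply/eqP; have /eqP := rhoE x i hx; rewrite rx0 big1 => [|j _].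
      by rewrite (divring_mulf_eq0 hD) (negPf nzx) orbF.
    by rewrite mxE rmorph0 mul0r.
  have [c /eqP] := hspan 1 (divsub1 hT).
  by rewrite big1 ?oner_eq0 // => i _; rewrite b0 mulr0.
Qed.
End RegularRepresentation.

(** * The commutation argument over an arithmetic base *)

Lemma factor_rmorphism (A : nzRingType) (F : fieldType) (D : nzRingType)
    (f : {rmorphism F -> D}) (g : {rmorphism A -> D}) :
  (forall a, exists k, g a = f k) ->
  exists j : {rmorphism A -> F}, forall a, g a = f (j a).
Proof.
move=> /choice[j hj]; have inj := fmorph_inj f.
have jB : zmod_morphism j by move=> a b; apply: inj; rewrite rmorphB -!hj rmorphB.
have jM : monoid_morphism j.
  by split=> [|a b]; apply: inj; rewrite ?rmorph1 ?rmorphM -!hj ?rmorph1 ?rmorphM.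
pose j' : {rmorphism A -> F} := HB.pack j (GRing.isZmodMorphism.Build A F j jB)
  (GRing.isMonoidMorphism.Build A F j jM).
by exists j'.
Qed.

(** Conjugating [a] by an element of [N i.+1] stays in the normal subgroup [N i], which contains
    [a]; each iteration thus goes one step down from [N r]. *)
Lemma iter_conj_subnormal (D : unitRingType) (N : nat -> D -> Prop) r (a x : D) :
  is_division_ring D ->
  (forall x, N r x <-> Dstar x) -> (forall i, (i <= r)%N -> subgroup_Dstar (N i)) ->
  (forall i, (i < r)%N -> normal_in (N i) (N i.+1)) ->
  N 0%N a -> x != 0 ->
  N 0%N (iter r (fun y => y * a * y^-1) x).
Proof.
move=> hD hr hsub hnorm ha nzx.
have aN i : (i <= r)%N -> N i a.
  elim: i => // i IH lti; have [h _] := hnorm i lti; apply: h; apply: IH; exact: ltnW.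
suff /(_ r (leqnn r)) : forall k, (k <= r)%N ->
    N (r - k)%N (iter k (fun y => y * a * y^-1) x) by rewrite subnn.
elim=> [|k IH] ltk; first by rewrite subn0; apply/hr.
have hk := IH (ltnW ltk); move: hk => /=; set y := iter _ _ _ => hy.
have e : (r - k)%N = (r - k.+1).+1 by lia.
have [_ _ _ hV] := hsub (r - k)%N (leq_subr _ _).
have [_ h] := hnorm (r - k.+1)%N ltac:(lia).
have := h y^-1 a; rewrite invrK; apply; first by rewrite -e; apply: hV.
by apply: aN; rewrite leq_subr.
Qed.

Lemma commute_of_arithmetic_base (D : unitRingType) (T G : D -> Prop)
    (s : seq D) (a b : D) :
  is_division_ring D -> division_subring T -> arithmetic_base T ->
  subnormal_Dstar G -> (forall x, G x <-> subgroup_gen s x) ->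
  (forall x, x \in s -> T x) -> G a -> T b -> a * b = b * a.
Proof.
move=> hD hT [A [iota [sparseA inji centeri fdT]]] hsn hs sT Ga Tb.
have [r [N [hN0 [hNr [hNsub hNnorm]]]]] := hsn.
have Gs x : x \in s -> G x by move=> hx; apply/hs => H _; apply.
have nzG x : G x -> x != 0.
  by move=> /hN0; have [_ h _ _] := hNsub 0%N (leq0n r); apply: h.
have hfr := fractions_division hD inji.
have frZ x : fractions iota x -> center_of T x.
  have hZ := center_of_division hT.
  move=> [c [d [_ ->]]]; apply: (divsubM hZ) => //; exact: (divsubV hZ).
have [F [f fE]] : exists (F : fieldType) (f : {rmorphism F -> D}),
    forall x, fractions iota x <-> exists k, x = f k.
  by apply: (subfield_exists hD hfr) => x y /frZ[_ h] /frZ[hy _]; apply: h.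
have centerf k : center_of T (f k) by apply/frZ/fE; exists k.
have [j jE] : exists j : {rmorphism A -> F}, forall c, iota c = f (j c).
  by apply: factor_rmorphism => c; apply/fE/sub_fractions.
have jinj : injective j by move=> c d e; apply: inji; rewrite !jE e.
have frac z : exists c d : A, d != 0 /\ z = j c / j d.
  have /fE[c [d [nzd h]]] : exists k, f z = f k by exists z.
  exists c, d; split=> //; apply: (fmorph_inj f).
  by rewrite rmorphM fmorphV -!jE.
have fdF : fin_dim (fun x => exists k, x = f k) T.
  by apply: fin_dim_wide fdT => x /fE.
have [n [rho [rho1 rhoM rhoL rho_inj]]] := regular_representation hD hT centerf fdF.
have [t0 t0inj _] := sparseA.
have jtinj : injective (j \o t0) by apply: inj_comp.
have T0 := divsub0 hT; have T1 := divsub1 hT.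
have TM x y : T x -> T y -> T (x * y) := @divsubM _ _ hT x y.
have TD x y : T x -> T y -> T (x + y) := @divsubD _ _ hT x y.
have TV x : T x -> T x^-1 := @divsubV _ _ hT x.
have Tf k : T (f k) by case: (centerf k).
have rhoB x y : T x -> T y -> rho (x - y) = rho x - rho y.
  by move=> hx hy; rewrite -mulN1r -(rmorphN1 f) rhoL // scaleN1r.
have TB x y : T x -> T y -> T (x - y) := @divsubB _ _ hT x y.
have rho_eq x y : T x -> T y -> rho x = rho y -> x = y.
  move=> hx hy e; apply/eqP; rewrite -subr_eq0; apply/eqP/rho_inj; first exact: TB.
  by rewrite rhoB // e subrr.
have rhoVr x : T x -> x != 0 -> rho x * rho x^-1 = 1.
  by move=> hx nzx; rewrite -rhoM ?divrr ?hD //; apply: (TV).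
have rhoU x : T x -> x != 0 -> rho x \is a GRing.unit.
  by move=> hx nzx; have [] := mulmx1_unit (rhoVr x hx nzx).
have rhoV x : T x -> x != 0 -> rho x^-1 = (rho x)^-1.
  by move=> hx nzx; apply: (mulrI (rhoU x hx nzx)); rewrite rhoVr // divrr // rhoU.
have rho0U x : T x -> rho x = 0 \/ rho x \is a GRing.unit.
  move=> hx; have [->|nzx] := eqVneq x 0; last by right; apply: (rhoU).
  by left; rewrite -(subrr 1) rhoB // subrr.
(* [M] will be a common denominator for the matrix entries of the generators and of their
   inverses. *)
pose zs := [seq rho x.1 x.2.1 x.2.2 | x <- allpairs pair (s ++ [seq x^-1 | x <- s])
  (enum {: 'I_n.+1 * 'I_n.+1})].
have [M nzM hM] := localized_seq jinj frac zs.
pose loc (B : 'M[F]_n.+1) := forall i l, localized j M (B i l).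
have loczs x : x \in s ++ [seq x^-1 | x <- s] -> loc (rho x).
  move=> hx i l; apply: hM; apply/mapP; exists (x, (i, l)) => //.
  by apply/allpairsP; exists (x, (i, l)); rewrite mem_enum.
have locM B C : loc B -> loc C -> loc (B * C).
  move=> hB hC i l; rewrite [B * C]/(B *m C) mxE; apply: localized_sum => k.
  exact: localizedM.
(* [H] is a group containing the generators, so all elements of [G] have matrix entries in
   [A[1/M]]. *)
pose H x := [/\ T x, x != 0, loc (rho x) & loc (rho x^-1)].
have hH : subgroup_Dstar H.
  split.
  - have loc1 : loc (rho 1).
      by move=> i l; rewrite rho1 mxE -(rmorph_nat j); apply: localized_img.
    by split; rewrite ?invr1 ?oner_neq0.
  - by move=> x [].
  - move=> x y [hx nzx lx lx'] [hy nzy ly ly']; split.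
    + exact: TM.
    + by rewrite (divring_mulf_eq0 hD) negb_or nzx.
    + by rewrite rhoM //; apply: (locM).
    + by rewrite invrM ?hD // rhoM; [apply: (locM)|apply: (TV)|apply: (TV)].
  - move=> x [hx nzx lx lx']; split; rewrite ?invrK //; first exact: TV.
    by apply: contraNneq nzx => h; rewrite -[x]invrK h invr0.
have GH x : G x -> H x.
  move=> /hs; apply=> // y hy; split; [exact: sT|exact/nzG/Gs|apply: (loczs)..].
    by rewrite mem_cat hy.
  by rewrite mem_cat map_f ?orbT.
have [Ta nza _ _] := GH a Ga.
apply: contrapT => nab.
pose X t := 1 + f t * b; pose phi y := y * a * y^-1; pose y k t := iter k phi (X t).
have TX t : T (X t) by apply: (TD) => //; apply: (TM).
(* If [1 + t b = 0], then [b = - 1 / t] is a central scalar and commutes with [a], contrary to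
   [nab]. *)
have nzX t : X t != 0.
  apply/negP; rewrite /X addrC addr_eq0 => /eqP h; apply: nab.
  have nzt : t != 0.
    apply: contra_eqN h => /eqP ->; rewrite rmorph0 mul0r eq_sym oppr_eq0.
    exact: oner_neq0.
  have -> : b = f (- t^-1).
    rewrite -[b]mul1r -(rmorph1 f) -(mulVf nzt) rmorphM -mulrA h mulrN1.
    by rewrite rmorphN.
  by have [_ ->] := centerf (- t^-1).
have yT k t : T (y k t) /\ y k t != 0.
  elim: k => [|k [hy nzy]] //=; split.
    by apply: (TM); [apply: (TM)|apply: (TV)].
  rewrite /phi !(divring_mulf_eq0 hD) !negb_or nzy nza /=.
  by apply: contraNneq nzy => h; rewrite -[y k t]invrK h invr0.
have rhoy k t : rho (y k.+1 t) = rho (y k t) *m rho a *m invmx (rho (y k t)).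
  have [hy nzy] := yT k t.
  have Tya := TM _ _ hy Ta; have TyV := TV _ hy.
  by rewrite /y iterS -/(y k t) {1}/phi rhoM // rhoM // rhoV.
have raty k : rational_mx (fun t => rho (y k t)).
  elim: k => [|k IH].
    under eq_fun do rewrite /y /= /X rhoL //.
    apply: rational_mxD; first exact: rational_mx_const.
    apply: rational_mxZ; [exact: rational_fun_id|exact: rational_mx_const].
  under eq_fun do rewrite rhoy.
  apply: rational_mxM; first by apply: rational_mxM => //; apply: rational_mx_const.
  by apply: rational_mx_inv => // t; case: (yT k t) => hy nzy; apply: (rhoU).
(* The entries of [rho (y r t)] are rational in [t], and lie in [A[1/M]] because [y r t] is in [G];
   hence they are constant. *)
have yr t : y r t = y r 0.
  have [h1 _] := yT r t; have [h2 _] := yT r 0.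
  apply: (rho_eq) => //; apply/matrixP => i l.
  apply: (rational_localized_const jinj frac sparseA (raty r i l) nzM) => u.
  have /GH[_ _ hl _] : G (y r u); last exact: hl.
  apply/hN0; apply: (iter_conj_subnormal hD hNr hNsub hNnorm _ (nzX u)).
  exact/hN0.
have y0 k : y k.+1 0 = a.
  elim: k => [|k IH].
    by rewrite /y /= /phi /X rmorph0 mul0r addr0 mul1r invr1 mulr1.
  by rewrite /y iterS -/(y k.+1 0) IH /phi mulrK // hD.
have comm_a k t : y k.+1 t = a -> a * y k t = y k t * a.
  have [hy nzy] := yT k t; rewrite /y iterS -/(y k t) => h.
  by rewrite -{1}h /phi divrK // hD.
(* Polynomials in [rho a] come from elements of the division ring [T], hence are zero or
   invertible. *)
have hornerT p : exists2 x, T x & rho x = horner_mx (rho a) p.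
  elim/poly_ind: p => [|p c [x hx ex]].
    by exists 0 => //; rewrite rmorph0 -(subrr 1) rhoB // subrr.
  exists (x * a + f c * 1); first by apply: (TD); apply: (TM).
  rewrite rhoL ?rhoM //; last exact: TM.
  by rewrite rmorphD rmorphM /= horner_mx_X horner_mx_C ex rho1 scalemx1.
(* [y k.+2 t = a] says that [y k.+1 t] commutes with [a]; being conjugate to [a], it also satisfies
   the characteristic polynomial of [rho a], so [conjugate_commuting_const] applies. *)
have down k : (forall t, y k.+2 t = a) -> forall t, y k.+1 t = a.
  move=> h t; have [hy _] := yT k.+1 t; apply: (rho_eq) => //.
  apply: (conjugate_commuting_const jtinj (raty k.+1)) => [||u|p|u].
  - by rewrite y0.
  - move=> u; have [hu _] := yT k.+1 u.
    by rewrite /GRing.comm -!rhoM // comm_a.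
  - rewrite rhoy horner_mx_uconj ?Cayley_Hamilton ?mulmx0 ?mul0mx //.
    by have [hu nzu] := yT k u; apply: (rhoU).
  - by have [x hx <-] := hornerT p; apply: (rho0U).
  - have [hu _] := yT k.+1 u; rewrite -rhoB //; apply: (rho0U); exact: TB.
have Xcomm : a * X 1 = X 1 * a.
  (* For [r = 0], constancy already gives [X 1 = X 0 = 1]. *)
  case: (r) yr => [|k] yr.
    have := yr 1; rewrite /y /= /X rmorph0 mul0r addr0 => ->.
    by rewrite mulr1 mul1r.
  have : forall t, y k.+1 t = a by move=> t; rewrite yr y0.
  by elim: k {yr} => [h|k IH /down]; [exact: (comm_a 0%N 1 (h 1))|].
apply: nab; move: Xcomm.
by rewrite /X rmorph1 mul1r mulrDr mulrDl mulr1 mul1r => /addrI.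
Qed.

Theorem theorem5p6 (D : unitRingType) (hD : is_division_ring D)
  (hwlf : weakly_locally_finite D) (G : D -> Prop)
  (hG : subgroup_Dstar G) (hsn : subnormal_Dstar G)
  (hfg : finitely_generated G) :
  forall x, G x -> center_D x.
Proof.
move=> a Ga b; have [s hs] := hfg.
pose T := divsubring_gen (fun x => x \in b :: s).
have hT : division_subring T by apply: divsubring_gen_division.
have Ts x : x \in b :: s -> T x := @sub_divsubring_gen _ _ x.
have Tb : T b by apply: Ts; apply: mem_head.
have sT x : x \in s -> T x by move=> hx; apply: Ts; rewrite inE hx orbT.
have by_base : arithmetic_base T -> a * b = b * a.
  by move=> base; apply: (commute_of_arithmetic_base hD hT base hsn hs).
have [cs [hcs fd]] := fin_dim_fin_gen_center hD (hwlf (b :: s)).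
case: (fin_dim_descend hD hT hcs fd) => // /(fin_dim_prime hD hT)[//|comm].
(* With [T] commutative it remains to see that [a] is in [T]: the nonzero elements of [T] form a
   group containing the generators of [G]. *)
apply: comm => //; have /hs := Ga.
move/(_ (fun x => T x /\ x != 0)); case=> //.
- split; first by split; [exact: (divsub1 hT)|exact: oner_neq0].
  + by move=> x [].
  + move=> x y [hx nzx] [hy nzy]; split; first exact: (divsubM hT).
    by rewrite (divring_mulf_eq0 hD) negb_or nzx.
  + move=> x [hx nzx]; split; first exact: (divsubV hT).
    by apply: contraNneq nzx => h; rewrite -[x]invrK h invr0.
- move=> x hx; split; first exact: sT.
  by have [_ h _ _] := hG; apply/h/hs => H _; apply.
Qed.
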